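(* Let $M(a,b,c)$ be a symmetric, strictly isotone mean which is twice differentiable in $\mathbb{R}_+^3$. Assume that $M_{zz}(x,y,z)$ is never $0$ on $\mathbb{R}_+^3$. If $m_1$ and $m_2$ are symmetric means in two variables such that $M$ is type 2 invariant with respect to $m_1$ and $M$ is type 2 invariant with respect to $m_2$, then $m_1=m_2$.
   Context: $\mathbb{R}_+^n=\{(a_1,\dots,a_n)\in\mathbb{R}^n: a_i>0\ \forall i\}$. A mean in $n$ variables is a continuous function $m$ on $\mathbb{R}_+^n$ with $\min(a_1,\dots,a_n)\le m(a_1,\dots,a_n)\le\max(a_1,\dots,a_n)$. It is symmetric if it is unchanged by every permutation of its arguments; strictly isotone if it is a strictly increasing function of each of its variables. $M(a,b,c)$ is type 2 invariant with respect to $m(a,b)$ if $M(a,b,m(a,b))=m(a,b)$ for all $(a,b)\in\mathbb{R}_+^2$. $M_{zz}$ denotes the second partial derivative of $M(x,y,z)$ with respect to its third variable. *)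

(* Defs.v *)
From HB Require Import structures.
From mathcomp Require Import all_boot all_order all_algebra all_fingroup.
From mathcomp Require Import all_classical all_reals all_analysis.

Set Implicit Arguments.
Unset Strict Implicit.
Unset Printing Implicit Defensive.

Import Order.TTheory GRing.Theory Num.Theory.
Import numFieldNormedType.Exports.

Local Open Scope classical_set_scope.
Local Open Scope ring_scope.

(* Functions on R_+^n are represented by total functions on 'rV[R]_n; the
   notions below do not depend on their values outside [Rpos]. *)
Definition Rpos {R : realType} {n : nat} : set 'rV[R]_n :=
  [set a | forall i, 0 < a 0 i].

Definition vec (R : realType) (n : nat) (t : n.-tuple R) : 'rV[R]_n :=
  \row_(i < n) tnth t i.

(* The default value a_0 of each iterated min/max is itself a coordinate. *)
Definition is_mean (R : realType) (n : nat) (m : 'rV[R]_n.+1 -> R) : Prop :=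
  {within Rpos, continuous m} /\
  forall a, Rpos a ->
    \big[Num.min/a 0 0]_(i < n.+1) a 0 i <= m a
      <= \big[Num.max/a 0 0]_(i < n.+1) a 0 i.

Definition is_symmetric (R : realType) (n : nat) (m : 'rV[R]_n -> R) : Prop :=
  forall (s : 'S_n) a, Rpos a -> m (col_perm s a) = m a.

Definition strictly_isotone (R : realType) (n : nat)
    (m : 'rV[R]_n -> R) : Prop :=
  forall (i : 'I_n) a b, Rpos a -> Rpos b ->
    (forall j, j != i -> a 0 j = b 0 j) -> a 0 i < b 0 i -> m a < m b.

(* The differential of f at x, a linear form on R^n, identified with the row
   vector of its values on the canonical basis. *)
Definition differential_row (R : realType) (n : nat) (f : 'rV[R]_n -> R)
    (x : 'rV[R]_n) : 'rV[R]_n :=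
  \row_(i < n) 'd f x (delta_mx 0 i).

(* Frechet differentiability of f and of its derivative x |-> 'd f x. *)
Definition twice_differentiable (R : realType) (n : nat)
    (f : 'rV[R]_n -> R) : Prop :=
  forall x, Rpos x ->
    differentiable f x /\ differentiable (differential_row f) x.

Definition partial (R : realType) (n : nat) (i : 'I_n) (f : 'rV[R]_n -> R) :
    'rV[R]_n -> R :=
  fun x => 'D_(delta_mx 0 i) f x.

Definition second_partial_z (R : realType) (M : 'rV[R]_3 -> R) :
    'rV[R]_3 -> R :=
  partial ord_max (partial ord_max M).

Definition type2_invariant (R : realType) (M : 'rV[R]_3 -> R)
    (m : 'rV[R]_2 -> R) : Prop :=
  forall a b : R, 0 < a -> 0 < b ->
    M (vec [tuple a; b; m (vec [tuple a; b])]) = m (vec [tuple a; b]).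

(* Main.v *)
(* Fix a <> b, let lo < hi be their minimum and maximum, and put
   f z = M(a,b,z) - z.  Since M(c,c,c) = c, strict isotonicity gives
   f lo > 0 > f hi, and m1(a,b), m2(a,b) are zeros of f in [lo, hi].  Two
   distinct zeros z1 < z2 would give, by the mean value theorem on [lo,z1],
   [z1,z2] and [z2,hi], three points c0 < c1 < c2 at which f' is negative,
   zero and negative; f' then has an interior maximum in [c0,c2], where
   f'' = M_zz vanishes. *)
Require Import Defs.
From HB Require Import structures.
From mathcomp Require Import all_boot all_order all_algebra all_fingroup.
From mathcomp Require Import all_classical all_reals all_analysis.
From mathcomp Require Import lra.

Set Implicit Arguments.
Unset Strict Implicit.
Unset Printing Implicit Defensive.

Import Order.TTheory GRing.Theory Num.Theory.
Import numFieldNormedType.Exports.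

Local Open Scope classical_set_scope.
Local Open Scope ring_scope.

(** The one-variable core, with [df] as f'. The contradiction comes from Fermat's rule at an
    interior maximum of [df], so it uses f'' at a single point. *)
Lemma sign_change_zero_lt_absurd (R : realType) (f df : R -> R)
    (lo hi z1 z2 : R) :
  (forall x, x \in `[lo, hi] -> is_derive x 1 f (df x)) ->
  (forall x, x \in `[lo, hi] -> derivable df x 1) ->
  (forall x, x \in `[lo, hi] -> 'D_1 df x <> 0) ->
  0 < f lo -> f hi < 0 -> lo <= z1 -> z1 < z2 -> z2 <= hi ->
  f z1 = 0 -> f z2 = 0 -> False.
Proof.
move=> fE ddf ddf0 flo fhi loz1 z12 z2hi fz1 fz2.
(* The strict signs of [f] at [lo] and [hi] keep the zeros off the endpoints, so the outer intervals
   are nondegenerate for the mean value theorem. *)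
have {}loz1 : lo < z1.
  by rewrite lt_neqAle loz1 andbT; apply: contraTneq flo => ->; rewrite fz1 ltxx.
have {}z2hi : z2 < hi.
  by rewrite lt_neqAle z2hi andbT; apply: contraTneq fhi => <-; rewrite fz2 ltxx.
have slope u v : lo <= u -> u < v -> v <= hi ->
    exists c, [/\ u < c, c < v & f v - f u = df c * (v - u)].
  move=> lou uv vhi.
  have sub x : x \in `[u, v] -> x \in `[lo, hi].
    by rewrite !in_itv/= => /andP[? ?]; apply/andP; split; lra.
  have dfuv x : x \in `]u, v[ -> is_derive x 1 f (df x).
    by move=> /subset_itv_oo_cc/sub/fE.
  have cf : {within `[u, v], continuous f}.
    by apply: derivable_within_continuous => y /sub/fE[].
  have [c] := MVT uv dfuv cf.
  by rewrite in_itv/= => /andP[? ?] ?; exists c.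
have lohi1 : z1 <= hi by lra.
have lohi2 : lo <= z2 by lra.
have [c0 [loc0 c0z1 e0]] := slope lo z1 (lexx _) loz1 lohi1.
have [c1 [z1c1 c1z2 e1]] := slope z1 z2 (ltW loz1) z12 (ltW z2hi).
have [c2 [z2c2 c2hi e2]] := slope z2 hi lohi2 z2hi (lexx _).
have c0c2 : c0 <= c2 by lra.
have df0 : df c0 < 0.
  by rewrite -(pmulr_llt0 (x := z1 - lo)) ?subr_gt0// -e0; lra.
have df1 : df c1 = 0.
  apply/eqP; move/esym/eqP: e1; rewrite fz1 fz2 subrr mulf_eq0.
  by rewrite subr_eq0 (gt_eqF z12) orbF.
have df2 : df c2 < 0.
  by rewrite -(pmulr_llt0 (x := hi - z2)) ?subr_gt0// -e2; lra.
have sub x : x \in `[c0, c2] -> x \in `[lo, hi].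
  by rewrite !in_itv/= => /andP[? ?]; apply/andP; split; lra.
have cdf : {within `[c0, c2], continuous df}.
  by apply: derivable_within_continuous => y /sub/ddf.
have [c c02 cmax] := EVT_max c0c2 cdf.
(* The maximum is at least [df c1 = 0], while [df] is negative at [c0] and [c2]; hence [c] is
   interior. *)
have dfc : 0 <= df c.
  by rewrite -df1; apply: cmax; rewrite in_itv/=; apply/andP; split; lra.
have cin : c \in `]c0, c2[.
  move: (c02); rewrite !in_itv/= !le_eqVlt.
  case/andP => /predU1P[cE|->]; first by move: dfc; rewrite -cE leNgt df0.
  by case/predU1P => [cE|->//]; move: dfc; rewrite cE leNgt df2.
apply: (ddf0 c); first exact: sub.
have : is_derive c 1 df 0.
  apply: (@derive1_at_max _ df c0 c2) => //.
    by move=> x xin; apply/ddf/sub; exact: subset_itv_oo_cc xin.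
  by move=> x xin; apply: cmax; exact: subset_itv_oo_cc xin.
exact: @derive_val.
Qed.

(** Restriction to this line parallel to the third axis turns [partial ord_max] into an ordinary
    derivative. *)
Definition zline (R : realType) (a b z : R) : 'rV[R]_3 := vec [tuple a; b; z].

Lemma zline_shift (R : realType) (a b z h : R) :
  zline a b (h *: 1 + z) = h *: delta_mx 0 ord_max + zline a b z.
Proof.
apply/rowP => i; rewrite !mxE !(tnth_nth 0)/=.
by case: i => [[|[|[|]]]] //= _; rewrite ?mulr0 ?add0r// mulr1.
Qed.

(** Both derivatives are limits of the same difference quotient, by [zline_shift]. *)
Lemma is_derive_zline (R : realType) (f : 'rV[R]_3 -> R) (a b z : R) :
  derivable f (zline a b z) (delta_mx 0 ord_max) ->
  is_derive z 1 (f \o zline a b) (partial ord_max f (zline a b z)).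
Proof.
have E : (fun h => h^-1 *: (((f \o zline a b) \o shift z) (h *: 1)
                            - (f \o zline a b) z)) =
         (fun h => h^-1 *: ((f \o shift (zline a b z))
                    (h *: delta_mx 0 ord_max) - f (zline a b z))).
  by apply/funext => h; rewrite /= zline_shift.
by move=> df; split; rewrite /partial /derivable /derive E.
Qed.

Lemma Rpos_zline (R : realType) (a b z : R) :
  0 < a -> 0 < b -> 0 < z -> Rpos (zline a b z).
Proof.
move=> a0 b0 z0 i; rewrite mxE (tnth_nth 0).
by case: i => [[|[|[|]]]] /=.
Qed.

Lemma partial_differential_row (R : realType) (n : nat) (f : 'rV[R]_n -> R)
    (i : 'I_n) (x : 'rV[R]_n) :
  differentiable f x -> partial i f x = differential_row f x 0 i.
Proof. by move=> df; rewrite mxE /partial deriveE. Qed.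

Lemma near_Rpos (R : realType) (n : nat) (x : 'rV[R]_n) :
  Rpos x -> \forall y \near x, Rpos y.
Proof.
move=> x0; apply: (@filter_forall _ _ (fun i (y : 'rV[R]_n) => 0 < y 0 i) (nbhs x)) => i.
exact: (@coord_continuous R 1 n 0 i x [set t | 0 < t] (lt_nbhsr (x0 i))).
Qed.

(** Since [Rpos] is open, [partial i f] agrees near [x] with the [i]-th coordinate of
    [differential_row f], which is differentiable at [x]. *)
Lemma derivable_partial (R : realType) (n : nat) (f : 'rV[R]_n -> R)
    (i : 'I_n) (x v : 'rV[R]_n) :
  twice_differentiable f -> Rpos x -> derivable (partial i f) x v.
Proof.
move=> f2 x0; have [_ d2] := f2 _ x0.
apply: (near_eq_derivable (f := fun y => differential_row f y 0 i)).
  near=> y; rewrite partial_differential_row//.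
  suff /f2[] : Rpos y by [].
  by near: y; exact: near_Rpos.
exact: (derivable_mxP _ _ _).1 (diff_derivable d2) 0 i.
Unshelve. all: by end_near. Qed.

Lemma mean_bounds (R : realType) (n : nat) (m : 'rV[R]_n.+1 -> R) (lo hi : R)
    (a : 'rV[R]_n.+1) :
  is_mean m -> Rpos a -> (forall i, lo <= a 0 i <= hi) -> lo <= m a <= hi.
Proof.
move=> [_ mm] a0 lohi; have /andP[lom mhi] := mm a a0.
apply/andP; split.
(* The default [a 0 0] is a coordinate, so the bound at index 0 settles the base case. *)
- apply: le_trans lom; apply: (big_ind (fun x => lo <= x)).
  + by case/andP: (lohi 0).
  + by move=> x y lox loy; rewrite le_min lox.
  + by move=> i _; case/andP: (lohi i).
- apply: le_trans mhi _; apply: (big_ind (fun x => x <= hi)).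
  + by case/andP: (lohi 0).
  + by move=> x y xhi yhi; rewrite ge_max xhi.
  + by move=> i _; case/andP: (lohi i).
Qed.

Lemma mean_pair (R : realType) (m : 'rV[R]_2 -> R) (a b : R) :
  is_mean m -> 0 < a -> 0 < b ->
  Num.min a b <= m (vec [tuple a; b]) <= Num.max a b.
Proof.
move=> mm a0 b0; apply: mean_bounds => // i; rewrite mxE (tnth_nth 0).
  by case: i => [[|[|]]].
case: i => [[|[|]]] //= _.
  by rewrite ge_min le_max lexx.
by rewrite ge_min le_max lexx !orbT.
Qed.

Lemma mean_diag (R : realType) (M : 'rV[R]_3 -> R) (c : R) :
  is_mean M -> 0 < c -> M (zline c c c) = c.
Proof.
(* Equality is read as a two-sided bound, with [lo] and [hi] of [mean_bounds] both equal to [c]. *)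
move=> MM c0; apply/eqP; rewrite eq_le andbC.
apply: mean_bounds => //; first exact: Rpos_zline.
by move=> i; rewrite mxE (tnth_nth 0); case: i => [[|[|[|]]]] //= _; rewrite lexx.
Qed.

Section zline_fixpoint.
Variables (R : realType) (M : 'rV[R]_3 -> R).
Hypothesis M_isotone : strictly_isotone M.

Lemma isotone_fst (a a' b z : R) :
  0 < a -> 0 < b -> 0 < z -> a < a' -> M (zline a b z) < M (zline a' b z).
Proof.
move=> a0 b0 z0 aa'; apply: (M_isotone (i := 0)).
- exact: Rpos_zline.
- by apply: Rpos_zline => //; exact: lt_trans aa'.
- by move=> [[|[|[|]]]] //= ? _; rewrite !mxE !(tnth_nth 0).
- by rewrite !mxE !(tnth_nth 0).
Qed.

Lemma isotone_snd (a b b' z : R) :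
  0 < a -> 0 < b -> 0 < z -> b < b' -> M (zline a b z) < M (zline a b' z).
Proof.
move=> a0 b0 z0 bb'; apply: (M_isotone (i := 1)).
- exact: Rpos_zline.
- by apply: Rpos_zline => //; exact: lt_trans bb'.
- by move=> [[|[|[|]]]] //= ? _; rewrite !mxE !(tnth_nth 0).
- by rewrite !mxE !(tnth_nth 0).
Qed.

Hypotheses (M_mean : is_mean M) (M_diff : twice_differentiable M).
Hypothesis Mzz_neq0 : forall x y z : R, 0 < x -> 0 < y -> 0 < z ->
  second_partial_z M (vec [tuple x; y; z]) <> 0.

(** With c the minimum, start from M(c,c,c) = c and raise one argument to the larger of [a] and [b].
    The bound at the maximum is dual. *)
Lemma zline_min_gt (a b : R) : 0 < a -> 0 < b -> a != b ->
  Num.min a b < M (zline a b (Num.min a b)).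
Proof.
move=> a0 b0; rewrite neq_lt => /orP[ab|ba].
- by rewrite min_l ?ltW// -{1}(mean_diag M_mean a0) isotone_snd.
- by rewrite min_r ?ltW// -{1}(mean_diag M_mean b0) isotone_fst.
Qed.

Lemma zline_max_lt (a b : R) : 0 < a -> 0 < b -> a != b ->
  M (zline a b (Num.max a b)) < Num.max a b.
Proof.
move=> a0 b0; rewrite neq_lt => /orP[ab|ba].
- by rewrite max_r ?ltW// -[ltRHS](mean_diag M_mean b0) isotone_fst.
- by rewrite max_l ?ltW// -[ltRHS](mean_diag M_mean a0) isotone_snd.
Qed.

Lemma zline_fixpoint_lt_absurd (a b z1 z2 : R) : 0 < a -> 0 < b -> a != b ->
  Num.min a b <= z1 -> z1 < z2 -> z2 <= Num.max a b ->
  M (zline a b z1) = z1 -> M (zline a b z2) = z2 -> False.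
Proof.
move=> a0 b0 ab az1 z12 z2b Mz1 Mz2.
have pos (x : R) : x \in `[Num.min a b, Num.max a b] -> 0 < x.
  by rewrite in_itv/= => /andP[+ _]; apply: lt_le_trans; rewrite lt_min a0.
(* This is the derivative of M(a,b,z) - z; the [- 0] below is the derivative of the constant 1. *)
pose p z := partial ord_max M (zline a b z) - 1.
have dp (x : R) : 0 < x ->
    is_derive x (1 : R) p (second_partial_z M (zline a b x) - 0).
  move=> x0; apply: is_deriveB; apply: is_derive_zline.
  by apply: derivable_partial => //; exact: Rpos_zline.
apply: (@sign_change_zero_lt_absurd R (fun z => M (zline a b z) - z) p
  (Num.min a b) (Num.max a b) z1 z2) => //.
- move=> x /pos x0; apply: is_deriveB; apply: is_derive_zline.
  by apply: diff_derivable; apply: (M_diff _).1; exact: Rpos_zline.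
- by move=> x /pos/dp[].
- move=> x /pos x0; have [_ ->] := dp x x0.
  by rewrite subr0; exact: Mzz_neq0.
- by rewrite subr_gt0 zline_min_gt.
- by rewrite subr_lt0 zline_max_lt.
- by rewrite Mz1 subrr.
- by rewrite Mz2 subrr.
Qed.

End zline_fixpoint.

Theorem theorem10 (R : realType) (M : 'rV[R]_3 -> R) (m1 m2 : 'rV[R]_2 -> R)
  (M_mean : is_mean M) (M_sym : is_symmetric M)
  (M_isotone : strictly_isotone M) (M_diff : twice_differentiable M)
  (Mzz_neq0 : forall x y z : R, 0 < x -> 0 < y -> 0 < z ->
     second_partial_z M (vec [tuple x; y; z]) <> 0)
  (m1_mean : is_mean m1) (m1_sym : is_symmetric m1)
  (m2_mean : is_mean m2) (m2_sym : is_symmetric m2)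
  (M_m1 : type2_invariant M m1) (M_m2 : type2_invariant M m2) :
  forall a b : R, 0 < a -> 0 < b ->
    m1 (vec [tuple a; b]) = m2 (vec [tuple a; b]).
Proof.
move=> a b a0 b0.
have /andP[lo1 hi1] := mean_pair m1_mean a0 b0.
have /andP[lo2 hi2] := mean_pair m2_mean a0 b0.
(* On the diagonal, minimum and maximum coincide and squeeze both means to [a]; the strict endpoint
   signs are available only off it. *)
have [ab|ab] := eqVneq a b.
  move: lo1 hi1 lo2 hi2; rewrite -ab minxx maxxx => ? ? ? ?.
  by apply/eqP; rewrite eq_le; apply/andP; split; lra.
have unique := zline_fixpoint_lt_absurd M_isotone M_mean M_diff Mzz_neq0 a0 b0 ab.
(* Invariance makes both mean values fixed points of z -> M(a,b,z); [unique] excludes either strict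
   order between them. *)
have := M_m1 _ _ a0 b0; have := M_m2 _ _ a0 b0; rewrite -!/(zline _ _ _) => M2 M1.
case: (ltgtP (m1 (vec [tuple a; b])) (m2 (vec [tuple a; b]))) => // lt12.
- by case: (unique _ _ lo1 lt12 hi2 M1 M2).
- by case: (unique _ _ lo2 lt12 hi1 M2 M1).
Qed.
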